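(* For any cardinal $\kappa\ge\omega$ and integer $d\ge2$, $w\chi_{\rm CF}(\kappa,\kappa,d)=\left\lfloor d/2\right\rfloor+1$.
   Context: A weak conflict free coloring of a family $\mathcal A$ with $\rho$ colors is a function $f$ with $\operatorname{dom}(f)\subseteq\bigcup\mathcal A$, values in $\rho$, such that every $A\in\mathcal A$ has some $\zeta<\rho$ with $|A\cap f^{-1}\{\zeta\}|=1$; $w\chi_{\rm CF}(\mathcal A)$ is the least such $\rho$. A $(\lambda,\kappa,\mu)$-system is a family of $\lambda$ sets each of size $\kappa$, distinct members meeting in fewer than $\mu$ points; $w\chi_{\rm CF}(\lambda,\kappa,\mu)$ is the supremum of $w\chi_{\rm CF}(\mathcal A)$ over all $(\lambda,\kappa,\mu)$-systems. *)

(* Defs.v *)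
(* Sets over a type U are predicates U -> Prop.
   A cardinal kappa is represented by a type K with |K| = kappa. *)
From Stdlib Require Import Arith.

Definition infinite_type (K : Type) : Prop :=
  exists e : nat -> K, forall m n, e m = e n -> m = n.

Definition equipotent (K U : Type) (A : U -> Prop) : Prop :=
  exists f : K -> U, (forall x y, f x = f y -> x = y) /\
    (forall u, A u <-> exists x, f x = u).

Definition card_lt_nat (U : Type) (B : U -> Prop) (d : nat) : Prop :=
  ~ exists g : nat -> U,
      (forall i j, i < d -> j < d -> g i = g j -> i = j) /\
      (forall i, i < d -> B (g i)).

Definition kkd_system (K I U : Type) (A : I -> U -> Prop) (d : nat) : Prop :=
  (exists h : K -> I, (forall x y, h x = h y -> x = y) /\ (forall i, exists x, h x = i)) /\
  (forall i j, A i = A j -> i = j) /\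
  (forall i, equipotent K U (A i)) /\
  (forall i j, i <> j -> card_lt_nat U (fun u => A i u /\ A j u) d).

(* weak conflict free coloring with rho colors: partial function f
   (f u = None means u is not in dom f), dom f within the union, values in rho *)
Definition wcf_coloring (I U : Type) (A : I -> U -> Prop) (rho : nat)
  (f : U -> option nat) : Prop :=
  (forall u c, f u = Some c -> c < rho /\ exists i, A i u) /\
  (forall i, exists c, c < rho /\
     exists u, A i u /\ f u = Some c /\
       forall v, A i v -> f v = Some c -> v = u).

Definition wcf_colorable (I U : Type) (A : I -> U -> Prop) (rho : nat) : Prop :=
  exists f, wcf_coloring I U A rho f.

(* Main.v *)
(* Upper bound. Put k = floor(d/2) and enumerate the system as (A_a) along a well-order of type
   kappa. Choose x_a in A_a outside every A_b with b < a and outside every other A_b that already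
   contains d earlier points: there are fewer than kappa such b, each of them determined by an
   earlier index or by d earlier points, and each meets A_a in fewer than d points. Thus A_b
   contains at most d of the points x_a with a < b, and none with a > b. If some color occurs
   exactly once among these earlier points, leave x_b uncolored; otherwise every color that occurs
   does so twice, so one of the k + 1 colors is missing since d < 2(k + 1), and x_b receives it.

   Lower bound. Build systems S_k that admit no k-coloring: S_0 is any nonempty system, and S_(k+1)
   consists of infinitely many disjoint copies of S_k together with, for every choice of one point
   p_i in the i-th copy (i < 2k + 2), the set of these points enlarged by kappa private points. In
   a (k+1)-coloring of S_(k+1) each copy uses all k + 1 colors, so some p carries every color
   twice. *)
Require Import Defs.
From Stdlib Require Import Arith.
From Stdlib Require Import Lia List FinFun Classical ClassicalEpsilon.
From Stdlib Require Import FunctionalExtensionality Relation_Operators Wellfounded.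
From Corelib Require Import ssreflect ssrfun.
From mathcomp Require eqtype boolp classical_sets functions wochoice cardinality.

(** * Embeddings, well-orders and comparability of cardinals *)

Lemma sval_inj (T : Type) (P : T -> Prop) : injective (@proj1_sig T P).
Proof. move=> x y /eq_sig_hprop; apply => ? ? ?; exact: proof_irrelevance. Qed.

Definition embeds (X Y : Type) : Prop := exists f : X -> Y, injective f.

Lemma embeds_trans (X Y Z : Type) : embeds X Y -> embeds Y Z -> embeds X Z.
Proof. by move=> [f fI] [g gI]; exists (fun x => g (f x)) => x y /gI /fI. Qed.

Definition strict_well_order (W : Type) (R : W -> W -> Prop) : Prop :=
  well_founded R /\ (forall x y z, R x y -> R y z -> R x z) /\
  (forall x y, R x y \/ x = y \/ R y x).

Section WellOrderingAndCantorBernstein.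
Import ssrbool eqtype boolp classical_sets functions wochoice cardinality.
Local Open Scope classical_set_scope.
Local Open Scope card_scope.

Lemma strict_well_order_exists (W : Type) :
  exists R : W -> W -> Prop, strict_well_order W R.
Proof.
case: (well_ordering_principle {classic W}) => Q woQ.
have woQT : wo_chain Q predT by move=> A _; apply: woQ.
have Qtot x y : Q x y || Q y x by apply: (wo_chainW woQT).
have Qanti x y : Q x y && Q y x -> x = y by apply: (wo_chain_antisymmetric woQT).
have Qmin (P : W -> Prop) : (exists x, P x) -> exists2 x, P x & forall y, P y -> Q x y.
  move=> [x Px].
  have [|z [[/asboolP Pz lbz] _]] := woQ (fun x => `[< P x >]).
    by exists x; apply/asboolP.
  by exists z => // y Py; apply: lbz; apply/asboolP.
(* Transitivity is read off the least element of the set formed by [x], [y] and [z]. *)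
have Qtr x y z : Q x y -> Q y z -> Q x z.
  move=> xy yz.
  have [|m [->|[->|->]] mle] := Qmin (fun t => t = x \/ t = y \/ t = z).
  - by exists x; left.
  - by apply: mle; right; right.
  - have e : x = y by apply: Qanti; rewrite xy mle //; left.
    by rewrite e.
  - have e : y = z by apply: Qanti; rewrite yz mle //; right; left.
    by rewrite -e.
exists (fun x y => Q x y /\ x <> y); split; [|split].
- move=> a; apply: NNPP => na.
  have [|m nm mle] := Qmin (fun x => ~ Acc (fun x y => Q x y /\ x <> y) x); first by exists a.
  apply: nm; constructor => y [ym nym]; apply: NNPP => ny.
  by apply: nym; apply: Qanti; rewrite ym mle.
- move=> x y z [xy nxy] [yz nyz]; split; first exact: Qtr yz.
  by move=> e; apply: nxy; apply: Qanti; rewrite xy e.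
- move=> x y; case: (EM (x = y)) => [|nxy]; first by right; left.
  by case/orP: (Qtot x y) => [xy|yx]; [left|right; right; split=> // /esym].
Qed.


Lemma embeds_card_le (X Y : Type) : embeds X Y -> [set: X] #<= [set: Y].
Proof.
move=> [f fI].
have [g] : $|{injfun [set: X] >-> [set: Y]}|.
  by apply/injfunPex; exists f => // x y _ _ /fI.
exact: inj_card_le.
Qed.

Lemma embeds_antisym (X Y : Type) :
  embeds X Y -> embeds Y X ->
  exists f : X -> Y, injective f /\ forall y, exists x, f x = y.
Proof.
move=> /embeds_card_le XY /embeds_card_le YX.
have /card_bijP[f [g fg gf]] := Cantor_Bernstein XY YX.
exists (fun x => proj1_sig (f (exist _ x (in_setT x)))); split.
  by move=> x y /sval_inj/(can_inj fg) [].
move=> y; pose t := g (exist _ y (in_setT y)); exists (proj1_sig t).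
have -> : exist (fun x => x \in [set: X]) (proj1_sig t) (in_setT _) = t by apply: sval_inj.
by rewrite gf.
Qed.
End WellOrderingAndCantorBernstein.

(** Well-founded recursion in which [epsilon] picks a value satisfying [Q] whenever there is one.
    The guarantee is conditional, so existence can be settled afterwards, stage by stage, or be
    allowed to fail. *)
Lemma transfinite_choice (W : Type) (R : W -> W -> Prop) (T : Type)
    (Q : forall w, ({v | R v w} -> T) -> T -> Prop) :
  well_founded R -> inhabited T ->
  exists g : W -> T, forall w,
    (exists t, Q w (fun v => g (proj1_sig v)) t) ->
    Q w (fun v => g (proj1_sig v)) (g w).
Proof.
move=> Rwf T0.
pose F w (rec : forall v, R v w -> T) : T :=
  epsilon T0 (Q w (fun v => rec (proj1_sig v) (proj2_sig v))).
exists (Fix Rwf (fun _ => T) F) => w ex.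
have -> : Fix Rwf (fun _ => T) F w = F w (fun v _ => Fix Rwf (fun _ => T) F v).
  apply: Fix_eq => x f g fg; have -> // : f = g.
  by do 2! apply: functional_extensionality_dep => ?.
exact: epsilon_spec.
Qed.

Definition seg (W : Type) (R : W -> W -> Prop) (a : W) : Type := {x | R x a}.

(** Elements of [X] successively take fresh elements of [Y]. If this never fails, it injects [X]
    into [Y]; if it fails at some stage, every element of [Y] has been taken, and choosing takers
    injects [Y] into [X]. *)
Lemma embeds_total (X Y : Type) : embeds X Y \/ embeds Y X.
Proof.
have [R [Rwf [_ Rtot]]] := strict_well_order_exists X.
have [g gP] := transfinite_choice X R (option Y)
  (fun x f t => exists2 y, t = Some y & forall v, f v <> Some y) Rwf (inhabits None).
case: (classic (forall x, exists2 y, g x = Some y & 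
    forall v : {v | R v x}, g (proj1_sig v) <> Some y)).
  move=> H; left.
  have /boolp.choice[f fP] : forall x, exists y, g x = Some y.
    by move=> x; case: (H x) => y; exists y.
  exists f => x y e.
  case: (Rtot x y) => [xy|[//|yx]].
  - case: (H y) => z; rewrite fP => -[<-] /(_ (exist _ x xy)) /=.
    by rewrite fP e.
  - case: (H x) => z; rewrite fP => -[<-] /(_ (exist _ y yx)) /=.
    by rewrite fP e.
move=> /not_all_ex_not[x nx]; right.
have /boolp.choice[f fP] : forall y, exists v, g v = Some y.
  move=> y; apply: NNPP => ny; apply: nx; apply: gP; exists (Some y), y => // v e.
  by apply: ny; exists (proj1_sig v).
by exists f => y z e; have := fP y; rewrite e fP => -[].
Qed.

(** * Infinite types and finite covers *)

Lemma infinite_embeds (X Y : Type) : embeds X Y -> infinite_type X -> infinite_type Y.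
Proof. by move=> [f fI] [e eI]; exists (fun n => f (e n)) => m n /fI/eI. Qed.

Lemma not_infinite_cover (X : Type) :
  ~ infinite_type X <-> exists l : list X, forall x, In x l.
Proof.
split; last first.
  move=> [l lP] [e eI].
  have nd : NoDup (map e (seq 0 (S (length l)))).
    by apply: Injective_map_NoDup; [exact: eI | exact: seq_NoDup].
  have := NoDup_incl_length nd (fun x _ => lP x).
  by rewrite length_map length_seq; lia.
(* Greedy choice: finitely many earlier values never exhaust [X], since a list of them would be a
   cover. *)
move=> nX; apply: NNPP => nl.
have [g gP] := transfinite_choice nat lt (option X)
  (fun n f t => exists2 x, t = Some x & forall v, f v <> Some x) lt_wf (inhabits None).
apply: nX.
have /boolp.choice[f fP] : forall n, exists x,
    g n = Some x /\ forall m, m < n -> g m <> Some x.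
  move=> n.
  have [|x -> xP] := gP n.
    apply: NNPP => nx; apply: nl.
    exists (flat_map (fun m => match g m with Some x => x :: nil | None => nil end) (seq 0 n)).
    move=> x; apply: NNPP => xl; apply: nx; exists (Some x), x => // -[m mn] /= e.
    apply: xl; apply/in_flat_map; exists m; rewrite e; split; last by left.
    by apply/in_seq; lia.
  by exists x; split=> // m mn; apply: (xP (exist _ m mn)).
exists f => m n e.
have [?|[//|?]] := Nat.lt_total m n.
- by have [_ /(_ m)] := fP n; have [-> _] := fP m; rewrite e => /(_ ltac:(done)).
- by have [_ /(_ n)] := fP m; have [-> _] := fP n; rewrite e => /(_ ltac:(done)).
Qed.

Lemma not_infinite_prod (X Y : Type) :
  ~ infinite_type X -> ~ infinite_type Y -> ~ infinite_type (X * Y).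
Proof.
move=> /not_infinite_cover[l lP] /not_infinite_cover[m mP].
apply/not_infinite_cover; exists (list_prod l m) => -[x y].
by apply/in_prod_iff.
Qed.

Lemma not_infinite_option (X : Type) : ~ infinite_type X -> ~ infinite_type (option X).
Proof.
move=> /not_infinite_cover[l lP].
apply/not_infinite_cover; exists (None :: map Some l) => -[x|]; last by left.
by right; apply/in_map.
Qed.

(** * Squares of infinite cardinals *)

Lemma embeds_prod (X X' Y Y' : Type) :
  embeds X X' -> embeds Y Y' -> embeds (X * Y) (X' * Y').
Proof.
move=> [f fI] [g gI]; exists (fun p => (f (fst p), g (snd p))).
by move=> [x y] [x' y'] /= [/fI-> /gI->].
Qed.

(** Hilbert's hotel: points of the sequence [e] move up by one, which frees [e 0] for [None]. *)
Lemma embeds_option (X : Type) : infinite_type X -> embeds (option X) X.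
Proof.
move=> [e eI].
pose f (o : option X) := match o with
  | None => e 0
  | Some x => match excluded_middle_informative (exists n, e n = x) with
              | left H => e (S (proj1_sig (constructive_indefinite_description _ H)))
              | right _ => x end end.
exists f => -[x|] [y|] //=.
- case: excluded_middle_informative => Hx; case: excluded_middle_informative => Hy.
  + by do 2! case: constructive_indefinite_description => ? /= <-; move=> /eI [->].
  + by move=> E; case: Hy; rewrite -E; eexists.
  + by move=> E; case: Hx; rewrite E; eexists.
  + by move=> ->.
- case: excluded_middle_informative => [|Hx]; first by move=> ? /eI.
  by move=> E; case: Hx; exists 0.
- case: excluded_middle_informative => [|Hx]; first by move=> ? /eI.
  by move=> E; case: Hx; exists 0.
Qed.

Lemma restrict_strict_well_order (W V : Type) (R : W -> W -> Prop) (f : V -> W) :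
  injective f -> strict_well_order W R -> strict_well_order V (fun x y => R (f x) (f y)).
Proof.
move=> fI [Rwf [Rtr Rtot]]; split; [|split].
- exact: wf_inverse_image.
- by move=> x y z; apply: Rtr.
- by move=> x y; have [|[/fI|]] := Rtot (f x) (f y); auto.
Qed.

Lemma embeds_seg_of_seg (W : Type) (R : W -> W -> Prop) (a : W) (b : seg W R a) :
  embeds (seg (seg W R a) (fun x y => R (proj1_sig x) (proj1_sig y)) b) (seg W R (proj1_sig b)).
Proof.
exists (fun s => exist (fun x => R x (proj1_sig b)) (proj1_sig (proj1_sig s)) (proj2_sig s)).
by move=> s t [/sval_inj/sval_inj].
Qed.

Lemma embeds_seg (W : Type) (R : W -> W -> Prop) (a : W) : embeds (seg W R a) W.
Proof. by exists (@proj1_sig _ _); apply: sval_inj. Qed.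

(* Goedel's pairing order on [T * T]: compare maxima first. Every proper initial segment is then
   contained in the square of a closed segment of [T], which is too small to contain [T]. *)
Lemma embeds_square_initial (T : Type) (R : T -> T -> Prop) :
  strict_well_order T R -> infinite_type T ->
  (forall b, ~ embeds T (seg T R b)) ->
  (forall b, infinite_type (seg T R b) -> embeds (seg T R b * seg T R b) (seg T R b)) ->
  embeds (T * T) T.
Proof.
move=> [Rwf [Rtr Rtot]] Tinf Tini IH.
pose mx (p : T * T) := match excluded_middle_informative (R (fst p) (snd p)) with
  | left _ => snd p | right _ => fst p end.
have mxP p : (fst p = mx p \/ R (fst p) (mx p)) /\ (snd p = mx p \/ R (snd p) (mx p)).
  rewrite /mx; case: excluded_middle_informative => H; first by auto.
  by have [|[|]] := Rtot (fst p) (snd p); auto.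
pose G p q := slexprod _ _ R (slexprod _ _ R R) (mx p, p) (mx q, q).
have Gwf : well_founded G.
  by apply: (wf_inverse_image _ _ _ (fun p => (mx p, p)));
    exact: wf_slexprod Rwf (wf_slexprod _ _ _ _ Rwf Rwf).
have Gtot p q : G p q \/ p = q \/ G q p.
  rewrite /G; have [|[e|]] := Rtot (mx p) (mx q); [by left; left| |by right; right; left].
  rewrite e; case: p {e} => p1 p2; case: q => q1 q2.
  have [|[<-|]] := Rtot p1 q1; [by left; right; left| |by right; right; right; left].
  have [|[<-|]] := Rtot p2 q2; [by left; right; right| |by right; right; right; right].
  by right; left.
have Gmx p q : G p q -> mx p = mx q \/ R (mx p) (mx q) by move=> h; inversion h; auto.
have Tinh : inhabited T by case: Tinf => e _; exists; exact: e 0.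
have [g gP] := transfinite_choice _ G T (fun p f t => forall q, f q <> t) Gwf Tinh.
suff gG p q : G q p -> g q <> g p.
  exists g => p q e; have [|[//|]] := Gtot p q => /gG; rewrite e => //.
move=> qp; apply: (gP p _ (exist _ q qp)).
(* If no fresh value remains at [p], the values at pairs below [p] already cover [T]. Both
   coordinates of such pairs are at most [mx p]. *)
apply: NNPP => nt.
have /boolp.choice[h hP] : forall t, exists q, G q p /\ g q = t.
  move=> t; apply: NNPP => nq; apply: nt; exists t => -[q' q'p] /= e.
  by apply: nq; exists q'.
pose m := mx p; pose S := seg T R m.
(* [c] codes the closed segment up to [m] in [option S], with [None] standing for [m] itself. *)
have [c cI] : exists c : T -> option S, forall x y,
    x = m \/ R x m -> y = m \/ R y m -> c x = c y -> x = y.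
  exists (fun x => match excluded_middle_informative (R x m) with
                   | left H => Some (exist _ x H) | right _ => None end) => x y.
  case: excluded_middle_informative => xm; case: excluded_middle_informative => ym //.
    by move=> _ _ [].
  by move=> [-> | //] [-> | //].
have le_m q' : G q' p -> (fst q' = m \/ R (fst q') m) /\ (snd q' = m \/ R (snd q') m).
  have tr x : x = mx q' \/ R x (mx q') -> G q' p -> x = m \/ R x m.
    move=> [->|xq] /Gmx [e|qm]; [by left|by right| |by right; apply: Rtr qm].
    by right; rewrite /m -e.
  by have [? ?] := mxP q'; split; apply: tr.
have T_SS : embeds T (option S * option S).
  exists (fun t => (c (fst (h t)), c (snd (h t)))) => s t [].
  have [/le_m[s1 s2] gs] := hP s; have [/le_m[t1 t2] gt] := hP t.
  move=> /(cI _ _ s1 t1) e1 /(cI _ _ s2 t2) e2.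
  by rewrite -gs -gt; congr g; rewrite (surjective_pairing (h s)) e1 e2 -surjective_pairing.
case: (classic (infinite_type S)) => Sinf.
  apply: (Tini m); apply: (embeds_trans _ _ _ T_SS); apply: embeds_trans (IH m Sinf).
  by apply: embeds_prod; apply: embeds_option.
by apply: (not_infinite_prod (option S) (option S)); try exact: not_infinite_option;
  apply: infinite_embeds Tinf.
Qed.

(** Either [T] embeds in one of its segments and inherits the square from it, or the order is
    initial and the pairing order applies. *)
Lemma embeds_square_of_segs (T : Type) (R : T -> T -> Prop) :
  strict_well_order T R ->
  (forall b, infinite_type (seg T R b) -> embeds (seg T R b * seg T R b) (seg T R b)) ->
  infinite_type T -> embeds (T * T) T.
Proof.
move=> Rwo IH Tinf.
case: (classic (exists b, embeds T (seg T R b))) => [[b Tb]|nb].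
  apply: (embeds_trans _ (seg T R b * seg T R b)); first exact: embeds_prod.
  apply: embeds_trans (embeds_seg _ R b); apply: IH; exact: infinite_embeds Tinf.
by apply: (embeds_square_initial T R) => // b Tb; apply: nb; exists b.
Qed.

(** Well-founded induction settles all infinite segments, because a segment of a segment is
    equinumerous with a segment of [T]; the same criterion then passes to [T]. *)
Lemma embeds_square (T : Type) : infinite_type T -> embeds (T * T) T.
Proof.
have [R Rwo] := strict_well_order_exists T.
apply: (embeds_square_of_segs T R) => //.
apply: (well_founded_ind (proj1 Rwo)) => a IH.
apply: (embeds_square_of_segs _ (fun x y => R (proj1_sig x) (proj1_sig y))).
  by apply: restrict_strict_well_order => //; apply: sval_inj.
move=> b binf.
have ab := embeds_seg_of_seg _ R a b.
have ba : embeds (seg T R (proj1_sig b))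
    (seg (seg T R a) (fun x y => R (proj1_sig x) (proj1_sig y)) b).
  have tr x : R x (proj1_sig b) -> R x a by move=> xb; apply: (proj1 (proj2 Rwo)) xb (proj2_sig b).
  exists (fun s => exist (fun x : seg T R a => R (proj1_sig x) (proj1_sig b))
                    (exist _ (proj1_sig s) (tr _ (proj2_sig s))) (proj2_sig s)).
  by move=> s t [/sval_inj].
apply: embeds_trans ba; apply: (embeds_trans _ _ _ (embeds_prod _ _ _ _ ab ab)).
by apply: IH; [exact: (proj2_sig b) | apply: infinite_embeds binf].
Qed.

(** * Initial well-orders and types of smaller cardinality *)

Lemma initial_order_exists (T : Type) :
  exists R : T -> T -> Prop, strict_well_order T R /\ forall a, ~ embeds T (seg T R a).
Proof.
have [R Rwo] := strict_well_order_exists T.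
case: (classic (exists a, embeds T (seg T R a))) => [[a0 Ta0]|na]; last first.
  by exists R; split=> // a Ta; apply: na; exists a.
(* With [a] least among the points whose segment receives [T], pulling [R] back along an embedding
   into that segment leaves only segments too small to receive [T]. *)
have [a [[f fI] amin]] : exists a, embeds T (seg T R a) /\
    forall b, R b a -> ~ embeds T (seg T R b).
  move: a0 Ta0; apply: (well_founded_ind (proj1 Rwo)) => a IH Ta.
  case: (classic (exists b, R b a /\ embeds T (seg T R b))) => [[b [ba Tb]]|nb].
    exact: IH ba Tb.
  by exists a; split=> // b ba Tb; apply: nb; exists b.
have fI' : injective (fun x => proj1_sig (f x)) by move=> x y /sval_inj/fI.
exists (fun x y => R (proj1_sig (f x)) (proj1_sig (f y))); split.
  exact: (restrict_strict_well_order _ _ R _ fI').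
move=> x Tx; apply: (amin _ (proj2_sig (f x))); apply: (embeds_trans _ _ _ Tx).
exists (fun s => exist (fun y => R y (proj1_sig (f x))) (proj1_sig (f (proj1_sig s)))
                  (proj2_sig s)).
by move=> s t [/fI'/sval_inj].
Qed.

(** By comparability this is strict inequality of cardinals. *)
Definition smaller (X T : Type) : Prop := ~ embeds T X.

Lemma smaller_embeds (T X Y : Type) : embeds X Y -> smaller Y T -> smaller X T.
Proof. by move=> XY sY TX; apply: sY; apply: embeds_trans XY. Qed.

Lemma smaller_of_not_infinite (T X : Type) :
  infinite_type T -> ~ infinite_type X -> smaller X T.
Proof. by move=> Tinf nX TX; apply: nX; apply: infinite_embeds Tinf. Qed.

(** By comparability the product lies in the square of the larger factor, which is no larger than
    that factor when infinite and is finite otherwise. *)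
Lemma smaller_prod (T X Y : Type) :
  infinite_type T -> smaller X T -> smaller Y T -> smaller (X * Y) T.
Proof.
move=> Tinf; have sq Z : smaller Z T -> smaller (Z * Z) T.
  case: (classic (infinite_type Z)) => Zinf sZ.
    by apply: smaller_embeds sZ; apply: embeds_square.
  by apply: smaller_of_not_infinite => //; apply: not_infinite_prod.
have idE Z : embeds Z Z by exists id.
move=> sX sY; have [XY|YX] := embeds_total X Y.
  by apply: smaller_embeds (sq Y sY); apply: embeds_prod.
by apply: smaller_embeds (sq X sX); apply: embeds_prod.
Qed.

Lemma not_infinite_bool : ~ infinite_type bool.
Proof. by apply/not_infinite_cover; exists (true :: false :: nil) => -[]; rewrite /=; auto. Qed.

Lemma smaller_sum (T X Y : Type) :
  infinite_type T -> smaller X T -> smaller Y T -> smaller (X + Y) T.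
Proof.
move=> Tinf sX sY.
suff E : exists2 Z, smaller Z T & embeds X Z /\ embeds Y Z.
  have [Z sZ [[f fI] [g gI]]] := E.
  apply: (smaller_embeds _ _ (bool * Z)).
    exists (fun s => match s with inl x => (true, f x) | inr y => (false, g y) end).
    by move=> [x|y] [x'|y'] // []; [move/fI-> | move/gI->].
  apply: smaller_prod => //; apply: smaller_of_not_infinite => //; exact: not_infinite_bool.
have idE Z : embeds Z Z by exists id.
by have [XY|YX] := embeds_total X Y; [exists Y | exists X].
Qed.

(** The index is a subtype of [nat] so that equality of tuples sees only the first [n] places. *)
Definition pow (X : Type) (n : nat) : Type := {i | i < n} -> X.

(** [P] is abstract in order to serve both smallness relative to [K] and embeddability into [K]. *)
Lemma pow_closed (P : Type -> Prop) (X : Type) (n : nat) :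
  (forall Y Z, embeds Y Z -> P Z -> P Y) -> P unit -> (forall Y Z, P Y -> P Z -> P (Y * Z)%type) ->
  P X -> P (pow X n).
Proof.
move=> Pe P1 Pp PX; elim: n => [|n IH].
  apply: Pe P1; exists (fun _ => tt) => f g _.
  by apply: functional_extensionality => -[i ?]; lia.
apply: Pe (Pp _ _ PX IH).
have lt_S i : i < n -> i < S n by lia.
exists (fun f => (f (exist _ n (Nat.lt_succ_diag_r n)),
            fun s => f (exist _ (proj1_sig s) (lt_S _ (proj2_sig s))))) => f g [en efg].
apply: functional_extensionality => -[i iS].
case: (Nat.eq_dec i n) => [e|ne].
  by subst i; rewrite (proof_irrelevance _ iS (Nat.lt_succ_diag_r n)).
have iN : i < n by lia.
have := f_equal (fun h => h (exist _ i iN)) efg; rewrite /=.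
by rewrite (proof_irrelevance _ iS (lt_S i iN)).
Qed.

(** * Counting with injective labels below a natural number *)

Lemma le_of_injective_on (m n : nat) (h : nat -> nat) :
  (forall i, i < m -> h i < n) ->
  (forall i j, i < m -> j < m -> h i = h j -> i = j) -> m <= n.
Proof.
move=> hlt hI.
have nd : NoDup (map h (seq 0 m)).
  apply: NoDup_map_NoDup_ForallPairs; last exact: seq_NoDup.
  by move=> i j /in_seq ? /in_seq ?; apply: hI; lia.
have : incl (map h (seq 0 m)) (seq 0 n).
  by move=> _ /in_map_iff[i [<- /in_seq ?]]; apply/in_seq; have := hlt i; lia.
by move=> /(NoDup_incl_length nd); rewrite length_map !length_seq.
Qed.

Lemma not_infinite_lt (n : nat) : ~ infinite_type {i | i < n}.
Proof.
move=> [e eI].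
have := le_of_injective_on (S n) n (fun i => proj1_sig (e i)).
move=> /(_ (fun i _ => proj2_sig (e i))) H.
suff : S n <= n by lia.
by apply: H => i j _ _ /sval_inj/eI.
Qed.

Lemma card_lt_nat_of_index (U : Type) (B : U -> Prop) (d m : nat) (h : U -> nat) :
  m < d -> (forall u, B u -> h u < m) ->
  (forall u v, B u -> B v -> h u = h v -> u = v) -> card_lt_nat U B d.
Proof.
move=> md hlt hI [g [gI gB]].
suff : d <= m by lia.
apply: (le_of_injective_on d m (fun i => h (g i))) => [i id|i j id jd e].
  by apply: hlt; apply: gB.
by apply: gI => //; apply: hI => //; apply: gB.
Qed.

Lemma index_of_card_lt_nat (U : Type) (B : U -> Prop) (d : nat) :
  card_lt_nat U B d ->
  exists h : U -> nat, (forall u, B u -> h u < d) /\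
    (forall u v, B u -> B v -> h u = h v -> u = v).
Proof.
elim: d B => [|d IH] B Bd.
  have nB u : ~ B u by move=> Bu; apply: Bd; exists (fun _ => u); split; lia.
  by exists (fun _ => 0); split=> [u /nB|u v /nB].
case: (classic (exists b, B b)) => [[b Bb]|nB]; last first.
  by exists (fun _ => 0); split=> [u Bu|u v Bu]; case: nB; exists u.
have [|h [hlt hI]] := IH (fun u => B u /\ u <> b).
  move=> [g [gI gB]]; apply: Bd.
  exists (fun i => if Nat.eqb i d then b else g i); split.
    move=> i j id jd; case: Nat.eqb_spec => ei; case: Nat.eqb_spec => ej; first by lia.
    - by move=> e; have [_ []] := gB j ltac:(lia).
    - by move=> e; have [_ []] := gB i ltac:(lia).
    - by apply: gI; lia.
  by move=> i id; case: Nat.eqb_spec => // ei; have [] := gB i ltac:(lia).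
exists (fun u => match excluded_middle_informative (u = b) with
                 | left _ => d | right _ => h u end); split.
  move=> u Bu; case: excluded_middle_informative => ub; first by lia.
  by have := hlt u (conj Bu ub); lia.
move=> u v Bu Bv.
case: excluded_middle_informative => ub; case: excluded_middle_informative => vb.
- by rewrite ub vb.
- by move=> e; have := hlt v (conj Bv vb); lia.
- by move=> e; have := hlt u (conj Bu ub); lia.
- exact: hI.
Qed.

(** * Upper bound: the sparse transversal and the greedy coloring *)

Lemma sparse_transversal_exists (K U : Type) (R : K -> K -> Prop) (A : K -> U -> Prop) (d : nat) :
  0 < d -> infinite_type K -> strict_well_order K R -> (forall a, ~ embeds K (seg K R a)) ->
  (forall a, exists f : K -> U, injective f /\ forall k, A a (f k)) ->
  (forall a b, a <> b -> card_lt_nat U (fun u => A a u /\ A b u) d) ->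
  exists x : K -> U, (forall a, A a (x a)) /\
    (forall a b, R b a -> ~ A b (x a)) /\
    (forall b, card_lt_nat K (fun a => R a b /\ A b (x a)) (S d)).
Proof.
move=> dpos Kinf [Rwf [Rtr Rtot]] Rini Abig Aint.
(* [full a b y] says that [A b] already contains [d] distinct points chosen before stage [a]. *)
pose full a b (y : seg K R a -> U) := exists g : nat -> seg K R a,
  (forall i j, i < d -> j < d -> y (g i) = y (g j) -> i = j) /\
  (forall i, i < d -> A b (y (g i))).
have Uinh : inhabited U.
  by case: Kinf => e _; have [f _] := Abig (e 0); exists; exact: f (e 0).
have [x xP] := transfinite_choice K R U
  (fun a y t => A a t /\ forall b, b <> a -> A b t -> ~ R b a /\ ~ full a b y) Rwf Uinh.
have {}xP a : A a (x a) /\ forall b, b <> a -> A b (x a) ->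
    ~ R b a /\ ~ full a b (fun s => x (proj1_sig s)).
  apply: xP; apply: NNPP => nt.
  have [f [fI fA]] := Abig a.
  pose S := seg K R a; pose y (s : S) := x (proj1_sig s).
  (* [code b w] witnesses that the points of [A b] are forbidden, and [w] determines [b]. *)
  pose code b (w : S + pow S d) := match w with
    | inl s => proj1_sig s = b
    | inr p => exists g : nat -> S, p = (fun i => g (proj1_sig i)) /\
        (forall i j, i < d -> j < d -> y (g i) = y (g j) -> i = j) /\
        (forall i, i < d -> A b (y (g i))) end.
  (* In the tuple case, two sets with the same code would share [d] distinct points. *)
  have codeI b b' w : code b w -> code b' w -> b = b'.
    case: w => [s|p] /=; first by move=> <- <-.
    move=> [g [-> [gI gb]]] [g' [e [_ gb']]]; apply: NNPP => /Aint; apply.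
    exists (fun i => y (g i)); split=> // i id; split; first exact: gb.
    by have /= -> := f_equal (fun h => h (exist _ i id)) e; apply: gb'.
  have /boolp.choice[idx idxP] : forall b, exists h : U -> nat, b <> a ->
      (forall u, A a u /\ A b u -> h u < d) /\
      (forall u v, A a u /\ A b u -> A a v /\ A b v -> h u = h v -> u = v).
    move=> b; case: (classic (b = a)) => [ba|nba]; first by exists (fun _ => 0).
    by have [|h hP] := index_of_card_lt_nat U (fun u => A a u /\ A b u) d;
      [apply: Aint => /esym|exists h].
  (* Each forbidden point [f k] is recovered from a code of the set [A b] that forbids it and its
     label in the intersection of [A a] and [A b]. There are too few such pairs to code [K]. *)
  have /boolp.choice[c cP] : forall k, exists c : (S + pow S d) * {i | i < d}, exists b,
      b <> a /\ A b (f k) /\ code b (fst c) /\ proj1_sig (snd c) = idx b (f k).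
    move=> k.
    have [b [ba [bk bad]]] : exists b, b <> a /\ A b (f k) /\ (R b a \/ full a b y).
      apply: NNPP => nb; apply: nt; exists (f k); split=> // b ba bk.
      by split=> ?; apply: nb; exists b; auto.
    have lt_d : idx b (f k) < d by apply: (proj1 (idxP b ba)).
    have [w wP] : exists w, code b w.
      case: bad => [Rba|[g gP]]; first by exists (inl (exist _ b Rba)).
      by exists (inr (fun i => g (proj1_sig i))), g.
    by exists (w, exist (fun i => i < d) _ lt_d), b.
  have sS : smaller S K by apply: Rini.
  suff : smaller ((S + pow S d) * {i | i < d}) K.
    apply; exists c => k l e; apply: fI.
    have [b [ba [bk [cb ib]]]] := cP k; have [b' [_ [bl [cb' ib']]]] := cP l.
    rewrite e in cb ib; have eb := codeI _ _ _ cb cb'; subst b'.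
    by apply: (proj2 (idxP b ba)) => //; rewrite -ib.
  apply: smaller_prod => //; last by apply: smaller_of_not_infinite => //; apply: not_infinite_lt.
  apply: smaller_sum => //; apply: (pow_closed (fun X => smaller X K)) => //.
  - by move=> Y Z; apply: smaller_embeds.
  - apply: smaller_of_not_infinite => //; apply/not_infinite_cover.
    by exists (tt :: nil) => -[]; left.
  - by move=> Y Z; apply: smaller_prod.
have Rirr a : ~ R a a by move: a; apply: (well_founded_ind Rwf) => a IH aa; apply: (IH a).
have xlow a b : R b a -> ~ A b (x a).
  move=> ba Ab; have [_ /(_ b)] := xP a; case=> //.
  by move=> e; apply: (Rirr a); rewrite -{1}e.
have xI a b : x a = x b -> a = b.
  move=> e; have [ab|[//|ba]] := Rtot a b.
    by case: (xlow b a ab); rewrite -e; have [] := xP a.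
  by case: (xlow a b ba); rewrite e; have [] := xP b.
exists x; split; [by move=> a; have [] := xP a | split=> // b [g [gI gA]]].
(* [g m] is the latest of the [S d] stages. The other [d] points come earlier and make [A b] full at
   stage [g m], so [x (g m)] could not have been taken in [A b]. *)
have [m [md mmax]] : exists m, m < S d /\ forall i, i < S d -> i <> m -> R (g i) (g m).
  elim: d gI {dpos xP full Aint gA} => [|n IH] gI; first by exists 0; split=> [|i]; lia.
  have [|m [mn mmax]] := IH; first by move=> i j ? ?; apply: gI; lia.
  have [lt|[e|gt]] := Rtot (g m) (g (S n)).
  - exists (S n); split=> // i iS ni; have [->//|im] := Nat.eq_dec i m.
    by apply: Rtr lt; apply: mmax => //; lia.
  - by have := gI m (S n) ltac:(lia) ltac:(lia) e; lia.
  - exists m; split=> [|i iS ni]; first by lia.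
    by have [->//|im] := Nat.eq_dec i (S n); apply: mmax => //; lia.
have [gmb Agm] := gA m md.
have [_ /(_ b)] := xP (g m); case=> //.
  by move=> e; apply: (Rirr b); rewrite {1}e.
move=> _; apply.
pose sh i := if Nat.ltb i m then i else S i.
have shP i : i < d -> sh i < S d /\ sh i <> m.
  by rewrite /sh; case: Nat.ltb_spec; lia.
(* [full] asks for a total function; indices from [d] on fall back to [0], which is in range as
   [0 < d]. *)
pose D i := match lt_dec i d with left H => i | right _ => 0 end.
have DP i : D i < d by rewrite /D; case: lt_dec.
have RD i : R (g (sh (D i))) (g m) by have [? ?] := shP _ (DP i); apply: mmax.
have DE i : i < d -> D i = i by rewrite /D; case: lt_dec.
exists (fun i => exist _ (g (sh (D i))) (RD i)); split=> /=.
  move=> i j id jd /xI; rewrite !DE //.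
  have [? ?] := shP i id; have [? ?] := shP j jd.
  move=> /gI; rewrite /sh; do 2! case: Nat.ltb_spec; lia.
by move=> i id; rewrite DE //; have [? ?] := shP i id; have [] := gA (sh i).
Qed.

(** If all [n] colors occurred, none of them exactly once, [B] would contain [2 * n > d] points. *)
Lemma missing_color_exists (X : Type) (B : X -> Prop) (c : X -> option nat) (d n : nat) :
  d < 2 * n -> card_lt_nat X B (S d) ->
  (forall e, e < n -> ~ exists s, B s /\ c s = Some e /\ forall t, B t -> c t = Some e -> t = s) ->
  exists e, e < n /\ forall s, B s -> c s <> Some e.
Proof.
move=> dn Bd nuniq; apply: NNPP => nmiss.
have /boolp.choice[a aP] : forall e, exists s, e < n -> B s /\ c s = Some e.
  have ex e : e < n -> exists s, B s /\ c s = Some e.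
    move=> en; apply: NNPP => ns; apply: nmiss; exists e; split=> // s Bs cs.
    by apply: ns; exists s.
  move=> e; case: (lt_dec e n) => [en|]; last by have [s _] := ex 0 ltac:(lia); exists s.
  by have [s sP] := ex e en; exists s.
have /boolp.choice[b bP] : forall e, exists t, e < n -> B t /\ c t = Some e /\ t <> a e.
  move=> e; case: (lt_dec e n) => [en|]; last by exists (a 0).
  apply: NNPP => nt; apply: (nuniq e en); exists (a e); have [? ?] := aP e en; do 2!split=> //.
  move=> t Bt ct; apply: NNPP => ta; apply: nt; exists t.
  by [].
(* Even places list the points [a e], odd places their partners [b e]; the first [S d <= 2 * n]
   entries are distinct. *)
apply: Bd; exists (fun i => if Nat.even i then a (Nat.div2 i) else b (Nat.div2 i)).
have half i : i < S d -> Nat.div2 i < n.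
  by have := Nat.div2_odd i; case: (Nat.odd i) => /=; lia.
split=> [i j id jd|i id]; last first.
  by case: (Nat.even i); [have [] := aP _ (half i id) | have [] := bP _ (half i id)].
have ei := Nat.div2_odd i; have ej := Nat.div2_odd j.
rewrite -!Nat.negb_odd.
have [_ ai] := aP _ (half i id); have [_ [bi nbi]] := bP _ (half i id).
have [_ aj] := aP _ (half j jd); have [_ [bj nbj]] := bP _ (half j jd).
move: ei ej; case: (Nat.odd i); case: (Nat.odd j) => /= ei ej e.
- by move: bi; rewrite e bj => -[]; lia.
- by move: bi; rewrite e aj => -[E]; case: nbi; rewrite e E.
- by move: ai; rewrite e bj => -[E]; case: nbj; rewrite -e E.
- by move: ai; rewrite e aj => -[]; lia.
Qed.

Lemma wcf_colorable_of_kkd_system (K I U : Type) (A : I -> U -> Prop) (d n : nat) :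
  infinite_type K -> 0 < d -> d < 2 * n -> kkd_system K I U A d -> wcf_colorable I U A n.
Proof.
move=> Kinf dpos dn [[h [hI hS]] [_ [Abig Aint]]].
have [R [Rwo Rini]] := initial_order_exists K.
have [||x [xA [xlow xd]]] :=
    sparse_transversal_exists K U R (fun a => A (h a)) d dpos Kinf Rwo Rini.
- move=> a; have [f [fI fA]] := Abig (h a).
  by exists f; split=> // k; apply/fA; exists k.
- by move=> a b ab; apply: Aint => /hI.
have [Rwf [_ Rtot]] := Rwo.
(* Either some color is already unique among the earlier points of [A (h b)] and the new point stays
   uncolored, or it receives a color absent from them. *)
pose good b (c : seg K R b -> option nat) o :=
  (o = None /\ exists e, e < n /\ exists s, A (h b) (x (proj1_sig s)) /\ c s = Some e /\
     forall t, A (h b) (x (proj1_sig t)) -> c t = Some e -> t = s) \/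
  (exists e, e < n /\ o = Some e /\ forall s, A (h b) (x (proj1_sig s)) -> c s <> Some e).
have [c cP] := transfinite_choice K R (option nat) good Rwf (inhabits None).
have {}cP b : good b (fun s => c (proj1_sig s)) (c b).
  apply: cP.
  case: (classic (exists e, e < n /\ exists s : seg K R b, A (h b) (x (proj1_sig s)) /\
      c (proj1_sig s) = Some e /\
      forall t : seg K R b, A (h b) (x (proj1_sig t)) -> c (proj1_sig t) = Some e -> t = s))
    => [ex|nex].
    by exists None; left.
  have [| |e [en eP]] := missing_color_exists (seg K R b) (fun s => A (h b) (x (proj1_sig s)))
      (fun s => c (proj1_sig s)) d n dn.
  - move=> [g [gI gA]]; apply: (xd b); exists (fun i => proj1_sig (g i)); split.
      by move=> i j id jd /sval_inj; apply: gI.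
    by move=> i id; split; [exact: (proj2_sig (g i)) | apply: gA].
  - by move=> e en ex; apply: nex; exists e.
  - by exists (Some e); right; exists e.
have xI a b : x a = x b -> a = b.
  move=> e; have [ab|[//|ba]] := Rtot a b.
    by case: (xlow b a ab); rewrite -e.
  by case: (xlow a b ba); rewrite e.
pose f u := match excluded_middle_informative (exists a, x a = u) with
  | left H => c (proj1_sig (constructive_indefinite_description _ H)) | right _ => None end.
have fx a : f (x a) = c a.
  rewrite /f; case: excluded_middle_informative => [H|]; last by case; exists a.
  by case: constructive_indefinite_description => b /= /xI ->.
have fSome u e : f u = Some e -> exists a, u = x a /\ c a = Some e.
  rewrite /f; case: excluded_middle_informative => // H.
  by case: constructive_indefinite_description => a /= <-; exists a.
exists f; split.
  move=> u e /fSome[a [-> ca]]; split; last by exists (h a).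
  by have [[]|[e' [en []]]] := cP a; rewrite ca // => -[->].
move=> i; have [b <-] := hS i.
(* Later points avoid [A (h b)] by [xlow], so uniqueness reached at stage [b] is never destroyed. *)
have below v e : A (h b) v -> f v = Some e -> exists a, v = x a /\ c a = Some e /\ (R a b \/ a = b).
  move=> Av /fSome[a [va ca]]; subst v; exists a; do 2!split=> //.
  by have [|[|/xlow]] := Rtot a b; auto.
have [[cb [e [en [s [sA [cs suniq]]]]]]|[e [en [cb emiss]]]] := cP b.
  exists e; split=> //; exists (x (proj1_sig s)); rewrite fx; do 2!split=> //.
  move=> v Av /(below _ _ Av)[a [va [ca [ab|ab]]]]; last by move: ca; rewrite ab cb.
  by subst v; rewrite -(suniq (exist (fun a => R a b) a ab)).
exists e; split=> //; exists (x b); rewrite fx; do 2!split=> //.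
move=> v Av /(below _ _ Av)[a [va [ca [ab|ab]]]]; last by rewrite va ab.
by subst v; case: (emiss (exist _ a ab)).
Qed.

(** * Lower bound: layered systems *)

Lemma embeds_sum (X Y T : Type) : infinite_type T -> embeds X T -> embeds Y T -> embeds (X + Y) T.
Proof.
move=> Tinf [f fI] [g gI]; apply: embeds_trans (embeds_square T Tinf).
have [e eI] := Tinf.
exists (fun s => match s with inl x => (e 0, f x) | inr y => (e 1, g y) end).
by move=> [x|x] [y|y] // [] => [/fI->|/eI|/eI|/gI->].
Qed.

Lemma card_lt_nat_image (U V : Type) (h : U -> V) (B : U -> Prop) (B' : V -> Prop) (d : nat) :
  0 < d -> (forall v, B' v -> exists u, B u /\ h u = v) ->
  card_lt_nat U B d -> card_lt_nat V B' d.
Proof.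
move=> dpos BB' Bd [g [gI gB]].
have [u0 _] := BB' _ (gB 0 dpos).
have /boolp.choice[k kP] : forall i, exists u, i < d -> B u /\ h u = g i.
  move=> i; case: (lt_dec i d) => [id|]; last by exists u0.
  by have [u uP] := BB' _ (gB i id); exists u.
apply: Bd; exists k; split=> [i j id jd e|i id]; last by have [] := kP i id.
by apply: gI => //; have [_ <-] := kP i id; have [_ <-] := kP j jd; rewrite e.
Qed.

(* Unlike [wcf_coloring], this leaves the domain and the values of [f] free: restricting a coloring
   to a copy of a smaller system may leave colored points outside its union. *)
Definition conflict_free (I U : Type) (A : I -> U -> Prop) (n : nat) (f : U -> option nat) : Prop :=
  forall i, exists c, c < n /\
    exists u, A i u /\ f u = Some c /\ forall v, A i v -> f v = Some c -> v = u.

(* The set [inr p] consists of the points [p i], the [i]-th one taken in copy [i], and of the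
   private points [inr (p, x)]. *)
Definition layered_system (I U K : Type) (n : nat) (A : I -> U -> Prop)
    (j : nat * I + pow U n) (v : nat * U + pow U n * K) : Prop :=
  match j, v with
  | inl (i, a), inl (i', u) => i' = i /\ A a u
  | inl _, inr _ => False
  | inr p, inl (i, u) => exists H : i < n, u = p (exist _ i H)
  | inr p, inr (q, _) => p = q
  end.

(** Distinct copies are disjoint, a copied set meets a tuple set in at most one point, and distinct
    tuples agree in at most [n - 1] places while their private points differ. *)
Lemma layered_system_intersections (I U K : Type) (A : I -> U -> Prop) (n d : nat) :
  n <= d -> 2 <= d ->
  (forall a b, a <> b -> card_lt_nat U (fun u => A a u /\ A b u) d) ->
  forall a b, a <> b ->
    card_lt_nat _ (fun v => layered_system I U K n A a v /\ layered_system I U K n A b v) d.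
Proof.
move=> nd d2 Aint.
have mixed i a p : card_lt_nat _ (fun v => layered_system I U K n A (inl (i, a)) v /\
    layered_system I U K n A (inr p) v) d.
  apply: (card_lt_nat_of_index _ _ d 1 (fun _ => 0)) => // [?|]; first by lia.
  move=> [[i1 u1]|[? ?]] [[i2 u2]|[? ?]] /= [h1 h2] [h3 h4] _ //.
  move: h1 h2 h3 h4 => [-> _] [H1 ->] [-> _] [H2 ->].
  by rewrite (proof_irrelevance _ H1 H2).
move=> [[i a]|p] [[j b]|q] ab.
- case: (Nat.eq_dec i j) => [e|ne].
    subst j; apply: (card_lt_nat_image U _ (fun u => inl (i, u)) (fun u => A a u /\ A b u));
      first by lia.
      by move=> [[i' u]|[? ?]] /= [] // [-> ?] [_ ?]; exists u.
    by apply: Aint => e; apply: ab; rewrite e.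
  apply: (card_lt_nat_of_index _ _ d 0 (fun _ => 0)); first by lia.
    by move=> [[i' u]|[? ?]] /= [] // [-> _] [].
  by move=> [[i' u]|[? ?]] ? /= [] // [-> _] [].
- exact: mixed.
- apply: (card_lt_nat_image _ _ id (fun v => layered_system I U K n A (inl (j, b)) v /\
    layered_system I U K n A (inr p) v)); [by lia| |exact: mixed].
  by move=> v [? ?]; exists v.
- have pq : p <> q by move=> e; apply: ab; rewrite e.
  have [[k kn] nk] : exists k, p k <> q k.
    apply: NNPP => nk; apply: pq; apply: functional_extensionality => k; apply: NNPP => ?.
    by apply: nk; exists k.
  (* Copy [k] contributes no common point, so copy [n - 1] may borrow its label and all labels stay
     below [n - 1]. *)
  apply: (card_lt_nat_of_index _ _ d (n - 1) (fun v => match v with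
     | inl (i, _) => if Nat.eqb i (n - 1) then k else i | inr _ => 0 end)); first by lia.
    move=> [[i u]|[? ?]] /= [] => [[H ->] [H' E]|<- e]; last by case: pq.
    have ik : i <> k.
      by move=> e; subst i; apply: nk;
        rewrite (proof_irrelevance _ kn H) E (proof_irrelevance _ H H').
    by case: Nat.eqb_spec; lia.
  move=> [[i u]|[? ?]] [[j v]|[? ?]] /=.
  + move=> [[H ->] [H' E]] [[J ->] [J' F]].
    have ik : i <> k.
      by move=> e; subst i; apply: nk;
        rewrite (proof_irrelevance _ kn H) E (proof_irrelevance _ H H').
    have jk : j <> k.
      by move=> e; subst j; apply: nk;
        rewrite (proof_irrelevance _ kn J) F (proof_irrelevance _ J J').
    move=> e; have ij : i = j by move: e; do 2!case: Nat.eqb_spec; lia.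
    by subst j; rewrite (proof_irrelevance _ H J).
  + by move=> _ [<- e]; case: pq.
  + by move=> [<- e]; case: pq.
  + by move=> [<- e]; case: pq.
Qed.

(** Every copy shows all [S k] colors, so some tuple has color [c] in copies [2 * c] and [2 * c + 1]
    for each [c]; coloring private points cannot undo these repetitions. *)
Lemma layered_system_not_conflict_free (I U K : Type) (A : I -> U -> Prop) (k : nat) :
  (forall f, ~ conflict_free I U A k f) ->
  forall f, ~ conflict_free _ _ (layered_system I U K (2 * S k) A) (S k) f.
Proof.
move=> Anc f fP.
have used i c : c < S k -> exists u, f (inl (i, u)) = Some c.
  move=> ck; apply: NNPP => nu.
  have miss u : f (inl (i, u)) <> Some c by move=> e; apply: nu; exists u.
  (* If [c] is missing in the [i]-th copy, rename the color [k] to [c] there: [k] colors suffice. *)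
  apply: (Anc (fun u => match f (inl (i, u)) with
    | Some e => Some (if Nat.eqb e k then c else e) | None => None end)) => a.
  have [e [ek [[[i' u]|q] [//= [-> Au] [fu uniq]]]]] := fP (inl (i, a)).
  have ec : e <> c by move=> E; apply: (miss u); rewrite fu E.
  exists (if Nat.eqb e k then c else e); split; first by case: Nat.eqb_spec; lia.
  exists u; rewrite fu; split=> //; split=> // v Av.
  case fv : (f (inl (i, v))) => [e'|//] [E].
  have e'c : e' <> c by move=> E'; apply: (miss v); rewrite fv E'.
  have ee' : e' = e by move: E; do 2!case: Nat.eqb_spec; lia.
  by have [] : inl (i, v) = inl (i, u) :> nat * U + pow U (2 * S k) * K
    by apply: uniq => //; rewrite fv ee'.
have /boolp.choice[h hP] : forall i, exists u, i < 2 * S k -> f (inl (i, u)) = Some (Nat.div2 i).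
  move=> i; case: (lt_dec i (2 * S k)) => [ik|nk];
    last by have [u _] := used i 0 ltac:(lia); exists u.
  have [|u uP] := used i (Nat.div2 i); last by exists u.
  by have := Nat.div2_odd i; case: (Nat.odd i) => /=; lia.
pose p : pow U (2 * S k) := fun s => h (proj1_sig s).
have [c [ck [u [_ [_ uniq]]]]] := fP (inr p).
have u0 : inl (2 * c, h (2 * c)) = u.
  apply: uniq; first by exists (ltac:(lia) : 2 * c < 2 * S k).
  by rewrite (hP (2 * c) ltac:(lia)) Nat.div2_double.
have : inl (S (2 * c), h (S (2 * c))) = u.
  apply: uniq; first by exists (ltac:(lia) : S (2 * c) < 2 * S k).
  by rewrite (hP (S (2 * c)) ltac:(lia)) Nat.div2_succ_double.
by rewrite -u0 => -[]; lia.
Qed.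

(** Embedding [U] in [K] is carried along the recursion to cap the size of the members. The bound
    [2 * k <= d] keeps the tuples short enough for intersections below [d]. *)
Lemma not_conflict_free_system_exists (K : Type) (d k : nat) :
  infinite_type K -> 2 <= d -> 2 * k <= d ->
  exists (I U : Type) (A : I -> U -> Prop),
    embeds I K /\ embeds K I /\ embeds U K /\
    (forall i, exists f : K -> U, injective f /\ forall x, A i (f x)) /\
    (forall i j, i <> j -> card_lt_nat U (fun u => A i u /\ A j u) d) /\
    (forall f, ~ conflict_free I U A k f).
Proof.
move=> Kinf d2; have sq := embeds_square K Kinf.
have idK : embeds K K by exists id.
elim: k => [|k IH] kd.
  (* The base system consists of the disjoint fibers of [K * K]; with no colors, any single member
     defeats a coloring. *)
  exists K, (K * K)%type, (fun i u => fst u = i); do 3!split=> //; split; [|split].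
  - by move=> i; exists (fun x => (i, x)); split=> // x y [].
  - move=> i j ij [g [_ gP]]; have [e e'] := gP 0 ltac:(lia).
    by apply: ij; rewrite -e.
  - by move=> f fP; case: Kinf => e _; have [c []] := fP (e 0); lia.
have [|I [U [A [IK [KI [UK [Abig [Aint Anc]]]]]]]] := IH; first by lia.
pose n := 2 * S k.
exists (nat * I + pow U n)%type, (nat * U + pow U n * K)%type, (layered_system I U K n A).
have prodK X Y : embeds X K -> embeds Y K -> embeds (X * Y) K.
  by move=> XK YK; apply: embeds_trans sq; apply: embeds_prod.
have powK : embeds (pow U n) K.
  apply: (pow_closed (fun X => embeds X K)) => //.
  - by move=> Y Z; apply: embeds_trans.
  - by case: Kinf => e _; exists (fun _ => e 0) => -[] [].
split; [|split; [|split; [|split; [|split]]]].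
- by apply: embeds_sum => //; apply: prodK.
- by apply: (embeds_trans _ _ _ KI); exists (fun i => inl (0, i)) => i j [].
- by apply: embeds_sum => //; apply: prodK.
- move=> [[i a]|p].
    have [f [fI fA]] := Abig a.
    by exists (fun x => inl (i, f x)); split=> // x y [/fI].
  by exists (fun x => inr (p, x)); split=> // x y [].
- exact: layered_system_intersections.
- exact: layered_system_not_conflict_free.
Qed.

Lemma equipotent_of_embeds (K U : Type) (B : U -> Prop) :
  embeds U K -> (exists f : K -> U, injective f /\ forall x, B (f x)) -> equipotent K U B.
Proof.
move=> UK [f [fI fB]].
have KB : embeds K {u | B u}.
  by exists (fun x => exist _ (f x) (fB x)) => x y [/fI].
have BK : embeds {u | B u} K.
  by apply: embeds_trans UK; exists (@proj1_sig _ _); apply: sval_inj.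
have [g [gI gS]] := embeds_antisym _ _ KB BK.
exists (fun x => proj1_sig (g x)); split; first by move=> x y /sval_inj/gI.
move=> u; split; last by move=> [x <-]; apply: proj2_sig.
by move=> Bu; have [x gx] := gS (exist _ u Bu); exists x; rewrite gx.
Qed.

Theorem theorem6p2 (K : Type) (d : nat) :
  infinite_type K -> 2 <= d ->
  (* every (kappa,kappa,d)-system has wchi_CF <= floor(d/2)+1 *)
  (forall (I U : Type) (A : I -> U -> Prop),
      kkd_system K I U A d -> wcf_colorable I U A (Nat.div d 2 + 1)) /\
  (* and some (kappa,kappa,d)-system has wchi_CF >= floor(d/2)+1 *)
  (exists (I U : Type) (A : I -> U -> Prop),
      kkd_system K I U A d /\
      forall rho, rho < Nat.div d 2 + 1 -> ~ wcf_colorable I U A rho).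
Proof.
move=> Kinf d2.
have half := Nat.div_mod_eq d 2; have rem := Nat.mod_upper_bound d 2 ltac:(lia).
split.
  by move=> I U A; apply: wcf_colorable_of_kkd_system => //; lia.
have [|I [U [A [IK [KI [UK [Abig [Aint Anc]]]]]]]] :=
  not_conflict_free_system_exists K d (Nat.div d 2) Kinf d2; first by lia.
exists I, U, A; split; [split; [|split; [|split]]|].
- exact: embeds_antisym.
(* Equal members at distinct indices would share infinitely many points. *)
- move=> i j Aij; apply: NNPP => /Aint; apply.
  have [e eI] := Kinf; have [f [fI fA]] := Abig i.
  exists (fun m => f (e m)); split; first by move=> m m' _ _ /fI/eI.
  by move=> m _; rewrite -Aij.
- by move=> i; apply: equipotent_of_embeds.
- exact: Aint.
(* Since [rho] is at most half of [d], its colors are among those excluded by [Anc]. *)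
- move=> rho rhod [f [_ fP]]; apply: (Anc f) => i.
  by have [c [crho cP]] := fP i; exists c; split=> //; lia.
Qed.
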